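(* Let $A\in\mathbb{R}^{n\times n}$ be symmetric positive definite, $b,x_0\in\mathbb{R}^n$, $x^\ast=A^{-1}b$, $k\in\{1,\dots,n-1\}$, $r_0=b-Ax_0$ and $\eta_i=s_i^\top r_0$ for $i=1,\dots,n$. For $\theta>0$ let $\Phi(\theta)=\|x^\ast-\hat x_1(\theta)\|_A^2$, where $\hat x_1(\theta)$ is the first iterate of the preconditioned conjugate gradient method for $Ax=b$ with preconditioner $F_\theta$ started from $x_0$. Then the unique $\theta_r$ with $\lambda_n\le\theta_r\le\lambda_{k+1}$ satisfying $$\theta_r\in\arg\min_{\theta>0}\Phi(\theta)$$ is $$\theta_r=\frac{\sum_{i=k+1}^n\lambda_i\eta_i^2}{\sum_{i=k+1}^n\eta_i^2}=\frac{r_0^\top Ar_0-r_0^\top S_k\Lambda_kS_k^\top r_0}{r_0^\top r_0-r_0^\top S_kS_k^\top r_0}.$$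
   Context: Notation: $A=S\Lambda S^\top$ is the spectral decomposition, with $\Lambda=\mathrm{diag}(\lambda_1,\dots,\lambda_n)$, $\lambda_1\ge\cdots\ge\lambda_n>0$, and $S=[s_1\ \cdots\ s_n]$ orthogonal. $S_k=[s_1\ \cdots\ s_k]$, $\Lambda_k=\mathrm{diag}(\lambda_1,\dots,\lambda_k)$. $\|x\|_A=\sqrt{x^\top Ax}$. Scaled spectral preconditioner: $F_\theta=I_n+\sum_{i=1}^k\left(\frac{\theta}{\lambda_i}-1\right)s_is_i^\top$. The first iterate of the preconditioned conjugate gradient method with preconditioner $F_\theta$ is $\hat x_1(\theta)=x_0+\frac{r_0^\top F_\theta r_0}{r_0^\top F_\theta AF_\theta r_0}F_\theta r_0$.
   Formalization: It is assumed that the denominator, the sum of η_i² over i>k, is nonzero (otherwise the formula is 0/0), and uniqueness is claimed only when S_k^T r_0 ≠ 0 (otherwise Φ is constant in θ and every θ>0 is a minimizer). *)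

(* Defs.v *)
From HB Require Import structures.
From mathcomp Require Import all_boot all_order all_algebra.
From mathcomp Require Import classical_sets reals.

Set Implicit Arguments.
Unset Strict Implicit.
Unset Printing Implicit Defensive.

Import Order.TTheory GRing.Theory Num.Theory.
Local Open Scope ring_scope.

Definition sym_posdef (R : realType) (n : nat) (A : 'M[R]_n) : Prop :=
  A^T = A /\ (forall x : 'cV[R]_n, x != 0 -> 0 < (x^T *m A *m x) 0 0).

(* Indices are shifted by one: [lam`_i] is $\lambda_{i+1}$ and [col i S] is
   $s_{i+1}$. *)
Definition spectral_decomposition (R : realType) (n : nat)
    (A S : 'M[R]_n) (lam : n.-tuple R) : Prop :=
  [/\ S^T *m S = 1%:M,
      sorted (fun x y : R => y <= x) lam,
      0 < lam`_n.-1
    & A = S *m diag_mx (\row_(i < n) lam`_i) *m S^T].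

Definition normA (R : realType) (n : nat) (A : 'M[R]_n) (x : 'cV[R]_n) : R :=
  Num.sqrt ((x^T *m A *m x) 0 0).

Definition scaled_precond (R : realType) (n : nat) (S : 'M[R]_n)
    (lam : n.-tuple R) (k : nat) (theta : R) : 'M[R]_n :=
  1%:M + \sum_(i < n | (i < k)%N)
           (theta / lam`_i - 1) *: (col i S *m (col i S)^T).

Definition residual (R : realType) (n : nat) (A : 'M[R]_n)
    (b x : 'cV[R]_n) : 'cV[R]_n :=
  b - A *m x.

Definition pcg_first_iterate (R : realType) (n : nat) (A F : 'M[R]_n)
    (b x0 : 'cV[R]_n) : 'cV[R]_n :=
  let r0 := residual A b x0 in
  x0 + ((r0^T *m F *m r0) 0 0 / (r0^T *m F *m A *m F *m r0) 0 0)
         *: (F *m r0).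

Definition Phi (R : realType) (n : nat) (A S : 'M[R]_n) (lam : n.-tuple R)
    (k : nat) (b x0 : 'cV[R]_n) (theta : R) : R :=
  normA A (invmx A *m b
           - pcg_first_iterate A (scaled_precond S lam k theta) b x0) ^+ 2.

Definition argmin (T : Type) (R : realType) (D : set T) (f : T -> R) : set T :=
  [set t | D t /\ forall u, D u -> f t <= f u]%classic.

Definition spec_coef (R : realType) (n : nat) (S : 'M[R]_n) (r0 : 'cV[R]_n)
    (i : 'I_n) : R :=
  ((col i S)^T *m r0) 0 0.

Definition first_cols (R : realType) (n k : nat) (hkn : (k < n)%N)
    (S : 'M[R]_n) : 'M[R]_(n, k) :=
  colsub (widen_ord (ltnW hkn)) S.

Definition first_diag (R : realType) (n k : nat) (lam : n.-tuple R) : 'M[R]_k :=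
  diag_mx (\row_(i < k) lam`_i).

(* Main.v *)
Require Import Defs.
From HB Require Import structures.
From mathcomp Require Import all_boot all_order all_algebra.
From mathcomp Require Import classical_sets reals.
From mathcomp Require Import ring.

(** Why the theorem is true.  In the eigenbasis, [A] and the preconditioner
    [F] at parameter [theta] are both diagonal, so with
    [a = \sum_(i < k) eta_i ^ 2 / lambda_i], [c = \sum_(i >= k) eta_i ^ 2] and
    [d = \sum_(i >= k) lambda_i * eta_i ^ 2] (indices starting at 0) one gets
    [r0^T F r0 = theta * a + c] and [r0^T F A F r0 = theta ^ 2 * a + d].
    The first iterate is the exact line search along [F r0], hence
    [Phi theta = r0^T A^-1 r0 - (theta * a + c) ^ 2 / (theta ^ 2 * a + d)]
    (lemma [Phi_rational]).

    By the Cauchy-Schwarz inequality the subtracted quotient, which is the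
    energy gained by the step, is at most [a + c ^ 2 / d].  Its defect from
    that bound is [a * (d - theta * c) ^ 2 / (d * (theta ^ 2 * a + d))]
    (lemma [gain_defect]).  The bound is thus reached at [theta = d / c], and
    only there when [a != 0], that is, when [r0] has a component along the
    first [k] eigenvectors.  Finally [d / c] is a weighted mean of the
    eigenvalues of index at least [k], which places it between the smallest
    eigenvalue and the eigenvalue of index [k], and the second formula for it
    comes from removing the first [k] terms of the full spectral sums. *)

Set Implicit Arguments.
Unset Strict Implicit.
Unset Printing Implicit Defensive.

Import Order.TTheory GRing.Theory Num.Theory.
Local Open Scope ring_scope.

(** * Functional calculus in an orthonormal eigenbasis *)

(** The matrix with eigenvectors the columns of [S] and eigenvalues [d]: for
    [d] equal to [f] of the eigenvalues of [A] this is [f(A)].  Both [A] and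
    the preconditioner have this form, so their products and quadratic forms
    reduce to scalar computations on [d]. *)
Definition spectral_mx (R : realType) (n : nat) (S : 'M[R]_n)
    (d : 'I_n -> R) : 'M[R]_n :=
  S *m diag_mx (\row_i d i) *m S^T.

Lemma diag_form (R : comPzRingType) (m : nat) (d : 'rV[R]_m) (y : 'cV[R]_m) :
  (y^T *m diag_mx d *m y) 0 0 = \sum_i d 0 i * y i 0 ^+ 2.
Proof.
rewrite mul_mx_diag mxE; apply: eq_bigr => i _.
by rewrite !mxE mulrAC mulrC expr2.
Qed.

Section SpectralCalculus.
Variables (R : realType) (n : nat) (S : 'M[R]_n).
Implicit Types (d e : 'I_n -> R) (x r : 'cV[R]_n).

Lemma spec_coefE x i : spec_coef S x i = (S^T *m x) i 0.
Proof. by rewrite /spec_coef !mxE; apply: eq_bigr => j _; rewrite !mxE. Qed.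

Lemma spectral_mx_tr d : (spectral_mx S d)^T = spectral_mx S d.
Proof. by rewrite /spectral_mx !trmx_mul trmxK tr_diag_mx mulmxA. Qed.

Lemma spectral_mx_sum d :
  spectral_mx S d = \sum_i d i *: (col i S *m (col i S)^T).
Proof.
apply/matrixP => p q; rewrite summxE !mxE; apply: eq_bigr => i _.
rewrite mul_mx_diag !mxE big_ord1 !mxE; ring.
Qed.

Lemma spectral_form d x :
  (x^T *m spectral_mx S d *m x) 0 0 = \sum_i d i * spec_coef S x i ^+ 2.
Proof.
have -> : x^T *m spectral_mx S d *m x =
    (S^T *m x)^T *m diag_mx (\row_i d i) *m (S^T *m x).
  by rewrite trmx_mul trmxK /spectral_mx !mulmxA.
by rewrite diag_form; apply: eq_bigr => i _; rewrite spec_coefE mxE.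
Qed.

Hypothesis orthoS : S^T *m S = 1%:M.

Lemma spectral_mx1 : spectral_mx S (fun=> 1) = 1%:M.
Proof.
rewrite /spectral_mx (_ : diag_mx _ = 1%:M) ?mulmx1 ?(mulmx1C orthoS) //.
by apply/matrixP => i j; rewrite !mxE.
Qed.

Lemma spectral_mxM d e :
  spectral_mx S d *m spectral_mx S e = spectral_mx S (fun i => d i * e i).
Proof.
rewrite /spectral_mx -!mulmxA (mulmxA S^T S) orthoS mul1mx.
rewrite (mulmxA (diag_mx _) (diag_mx _)) mulmx_diag.
by congr (_ *m (diag_mx _ *m _)); apply/rowP => i; rewrite !mxE.
Qed.

Lemma spectral_mx_unit d :
  (forall i, d i != 0) -> spectral_mx S d \in unitmx.
Proof.
move=> d_neq0; have /mulmx1_unit [//] :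
  spectral_mx S d *m spectral_mx S (fun i => (d i)^-1) = 1%:M.
rewrite spectral_mxM -spectral_mx1 /spectral_mx.
by congr (_ *m diag_mx _ *m _); apply/rowP => i; rewrite !mxE divff.
Qed.

(** Rank-one updates along orthonormal eigenvectors only modify eigenvalues:
    writing the identity as [\sum_i s_i s_i^T], the update of index [i < k]
    turns the eigenvalue 1 into [theta / lambda_i]. *)
Lemma scaled_precond_spectral (lam : n.-tuple R) k theta :
  scaled_precond S lam k theta =
    spectral_mx S (fun i => if (i < k)%N then theta / lam`_i else 1).
Proof.
rewrite /scaled_precond -spectral_mx1 !spectral_mx_sum.
rewrite [X in _ + X]big_mkcond -big_split /=; apply: eq_bigr => i _.
by case: ifP => _; rewrite ?addr0 // -scalerDl addrC subrK.
Qed.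

End SpectralCalculus.

(** * Quadratic forms in the leading eigenvectors *)

Section LeadingBlock.
Variables (R : realType) (n k : nat) (hkn : (k < n)%N) (S : 'M[R]_n).
Variable r : 'cV[R]_n.

Lemma first_cols_coef i :
  ((first_cols hkn S)^T *m r) i 0 = spec_coef S r (widen_ord (ltnW hkn) i).
Proof. by rewrite spec_coefE !mxE; apply: eq_bigr => j _; rewrite !mxE. Qed.

Lemma first_cols_form (d : 'rV[R]_k) (f : nat -> R) :
  (forall i : 'I_k, d 0 i = f i) ->
  (r^T *m first_cols hkn S *m diag_mx d *m (first_cols hkn S)^T *m r) 0 0 =
    \sum_(i < n | (i < k)%N) f i * spec_coef S r i ^+ 2.
Proof.
move=> df; set T := first_cols hkn S.
have -> : r^T *m T *m diag_mx d *m T^T *m r =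
    (T^T *m r)^T *m diag_mx d *m (T^T *m r).
  by rewrite trmx_mul trmxK !mulmxA.
rewrite (big_ord_narrow (ltnW hkn)) diag_form; apply: eq_bigr => i _.
by rewrite first_cols_coef df.
Qed.

End LeadingBlock.

(** * Exact line search *)

(** With [A e = r], the squared energy norm of [e - t p] is a quadratic
    polynomial in [t].  The step [t = (p^T r) / (p^T A p)] is its vertex,
    where it drops by [(p^T r) ^ 2 / (p^T A p)]. *)
Lemma line_search_energy (R : realType) (n : nat) (A : 'M[R]_n)
    (e r p : 'cV[R]_n) :
  A^T = A -> A *m e = r -> (p^T *m A *m p) 0 0 != 0 ->
  let y := e - ((p^T *m r) 0 0 / (p^T *m A *m p) 0 0) *: p in
  (y^T *m A *m y) 0 0 =
    (e^T *m r) 0 0 - (p^T *m r) 0 0 ^+ 2 / (p^T *m A *m p) 0 0.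
Proof.
move=> symA Ae v_neq0 /=; set t := _ / _.
have pAe : p^T *m A *m e = p^T *m r by rewrite -mulmxA Ae.
have eAp : e^T *m A *m p = r^T *m p by rewrite -Ae trmx_mul symA.
have rp : (r^T *m p) 0 0 = (p^T *m r) 0 0.
  by rewrite -[r^T *m p]trmxK mxE trmx_mul trmxK.
have -> : (e - t *: p)^T = e^T - t *: p^T by rewrite linearB /= linearZ.
rewrite !(mulmxBl, mulmxBr) -!(scalemxAl, scalemxAr).
rewrite pAe eAp -mulmxA Ae.
have mxB (X Y : 'M[R]_1) : (X - Y) 0 0 = X 0 0 - Y 0 0 by rewrite !mxE.
have mxZ (c : R) (X : 'M[R]_1) : (c *: X) 0 0 = c * X 0 0 by rewrite mxE.
by rewrite !(mxB, mxZ) rp /t; field.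
Qed.

(** Equality case of the Cauchy-Schwarz inequality for the vectors
    [(t * sqrt a, sqrt d)] and [(sqrt a, c / sqrt d)]: the numerator on the
    right is, up to the factor [d], the square of their determinant. *)
Lemma gain_defect (R : realFieldType) (a c d t : R) : 0 <= a -> 0 < d ->
  a + c ^+ 2 / d - (t * a + c) ^+ 2 / (t ^+ 2 * a + d) =
    a * (d - t * c) ^+ 2 / (d * (t ^+ 2 * a + d)).
Proof.
move=> a_ge0 d_gt0; have v_neq0 : t ^+ 2 * a + d != 0.
  by rewrite gt_eqF // ltr_wpDl // mulr_ge0 // sqr_ge0.
by field; rewrite v_neq0 gt_eqF.
Qed.

(** * The objective as a function of the scaling parameter *)

Section Objective.
Variables (R : realType) (n k : nat) (A S : 'M[R]_n) (lam : n.-tuple R).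
Variables (b x0 : 'cV[R]_n).
Hypothesis hA : sym_posdef A.
Hypothesis hspec : spectral_decomposition A S lam.

Let r0 := residual A b x0.
Let eta := spec_coef S r0.

Lemma spectral_decomposition_mx : A = spectral_mx S (fun i => lam`_i).
Proof. by case: hspec. Qed.

Lemma eigenvalue_antitone i j : (i <= j)%N -> (j < n)%N -> lam`_j <= lam`_i.
Proof.
case: hspec => _ lam_sorted _ _ leij ltjn.
have ge_trans : transitive (fun x y : R => y <= x).
  by move=> y x z /= yx zy; apply: le_trans zy yx.
apply: (sorted_leq_nth ge_trans (@lexx _ R) 0 lam_sorted) => //.
  by rewrite inE size_tuple (leq_ltn_trans leij).
by rewrite inE size_tuple.
Qed.

Lemma last_eigenvalue_le (i : 'I_n) : lam`_n.-1 <= lam`_i.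
Proof.
have n_gt0 : (0 < n)%N by apply: leq_ltn_trans (ltn_ord i).
by apply: eigenvalue_antitone; rewrite ?ltn_predL // -ltnS prednK.
Qed.

Lemma eigenvalue_gt0 (i : 'I_n) : 0 < lam`_i.
Proof.
case: hspec => _ _ lam_last _; apply: lt_le_trans lam_last _.
exact: last_eigenvalue_le.
Qed.

Let a := \sum_(i < n | (i < k)%N) eta i ^+ 2 / lam`_i.
Let c := \sum_(i < n | (k <= i)%N) eta i ^+ 2.
Let d := \sum_(i < n | (k <= i)%N) lam`_i * eta i ^+ 2.

Lemma head_weight_ge0 : 0 <= a.
Proof.
by apply: sumr_ge0 => i _; rewrite divr_ge0 ?sqr_ge0 // ltW // eigenvalue_gt0.
Qed.

Lemma curvature_gt0 theta : 0 < d -> 0 < theta ^+ 2 * a + d.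
Proof.
by move=> d_gt0; rewrite ltr_wpDl // mulr_ge0 ?sqr_ge0 ?head_weight_ge0.
Qed.

Lemma tail_norm_ge0 : 0 <= c.
Proof. by apply: sumr_ge0 => i _; rewrite sqr_ge0. Qed.

Lemma tail_energy_ge : lam`_n.-1 * c <= d.
Proof.
rewrite mulr_sumr; apply: ler_sum => i _; rewrite ler_wpM2r ?sqr_ge0 //.
exact: last_eigenvalue_le.
Qed.

Lemma tail_energy_le : d <= lam`_k * c.
Proof.
rewrite mulr_sumr; apply: ler_sum => i ki; rewrite ler_wpM2r ?sqr_ge0 //.
exact: eigenvalue_antitone.
Qed.

Lemma normA_sqr x : normA A x ^+ 2 = (x^T *m A *m x) 0 0.
Proof.
rewrite /normA sqr_sqrtr //; have [-> | x_neq0] := eqVneq x 0.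
  by rewrite mulmx0 mxE.
by rewrite ltW //; case: hA => _; apply.
Qed.

(** The initial error is [invmx A *m r0], and the first iterate is the exact
    line search from [x0] along [F *m r0].  On the first [k] eigenvectors the
    eigenvalues of [F] and [F A F] are [theta / lambda_i] and
    [theta ^ 2 / lambda_i], on the others [1] and [lambda_i]. *)
Lemma Phi_rational theta : 0 < d ->
  Phi A S lam k b x0 theta =
    (r0^T *m invmx A *m r0) 0 0
    - (theta * a + c) ^+ 2 / (theta ^+ 2 * a + d).
Proof.
move=> d_gt0; have [orthoS _ _ _] := hspec; have [symA _] := hA.
have A_spec := spectral_decomposition_mx.
have lam_neq0 (i : 'I_n) : lam`_i != 0 by rewrite gt_eqF ?eigenvalue_gt0.
have A_unit : A \in unitmx by rewrite A_spec spectral_mx_unit.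
set F := scaled_precond S lam k theta.
have F_spec : F = spectral_mx S _ := scaled_precond_spectral orthoS lam k theta.
have symF : F^T = F by rewrite F_spec spectral_mx_tr.
have FrE : (F *m r0)^T = r0^T *m F by rewrite trmx_mul symF.
have rFr : (r0^T *m F *m r0) 0 0 = theta * a + c.
  rewrite F_spec spectral_form (bigID (fun i : 'I_n => (i < k)%N)) /=.
  congr (_ + _); last first.
    by apply: eq_big => i; [rewrite -leqNgt | move=> /negbTE ->; rewrite mul1r].
  by rewrite mulr_sumr; apply: eq_bigr => i ->; rewrite mulrAC mulrA.
have rFAFr : (r0^T *m F *m A *m F *m r0) 0 0 = theta ^+ 2 * a + d.
  rewrite -(mulmxA r0^T) -(mulmxA r0^T) F_spec A_spec !spectral_mxM //.
  rewrite spectral_form (bigID (fun i : 'I_n => (i < k)%N)) /=.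
  congr (_ + _); last first.
    apply: eq_big => i; first by rewrite -leqNgt.
    by move=> /negbTE ->; rewrite mul1r mulr1.
  by rewrite mulr_sumr; apply: eq_bigr => i ->; rewrite /eta; field.
have v_neq0 : theta ^+ 2 * a + d != 0 by rewrite gt_eqF ?curvature_gt0.
have Ae : A *m (invmx A *m r0) = r0 by rewrite mulmxA mulmxV ?mul1mx.
have pAp : (F *m r0)^T *m A *m (F *m r0) = r0^T *m F *m A *m F *m r0.
  by rewrite FrE !mulmxA.
have := line_search_energy symA Ae (p := F *m r0).
rewrite pAp FrE rFAFr rFr => /(_ v_neq0).
rewrite trmx_mul trmx_inv symA => <-.
rewrite /Phi normA_sqr /pcg_first_iterate -/F -/r0 rFAFr rFr.
set t := _ / _.
suff -> : invmx A *m b - (x0 + t *: (F *m r0))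
    = invmx A *m r0 - t *: (F *m r0) by [].
by rewrite [in invmx A *m r0]mulmxBr mulKmx // opprD addrA.
Qed.

Hypothesis hd : 0 < d.

(** This form confines the dependence on [theta] to one nonnegative term,
    which vanishes at [d / c]; both the minimality of [d / c] and its
    uniqueness can be read off it. *)
Lemma Phi_excess theta :
  Phi A S lam k b x0 theta =
    (r0^T *m invmx A *m r0) 0 0 - (a + c ^+ 2 / d)
    + a * (d - theta * c) ^+ 2 / (d * (theta ^+ 2 * a + d)).
Proof. by rewrite Phi_rational // -gain_defect ?head_weight_ge0 //; ring. Qed.

Lemma Phi_min theta : c != 0 ->
  Phi A S lam k b x0 (d / c) <= Phi A S lam k b x0 theta.
Proof.
move=> c_neq0; rewrite !Phi_excess divfK // subrr expr0n mulr0 mul0r addr0.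
rewrite lerDl divr_ge0 // mulr_ge0 ?sqr_ge0 ?head_weight_ge0 ?ltW //.
exact: curvature_gt0.
Qed.

Lemma Phi_min_unique theta : c != 0 -> a != 0 ->
  Phi A S lam k b x0 theta <= Phi A S lam k b x0 (d / c) -> theta = d / c.
Proof.
move=> c_neq0 a_neq0.
rewrite !Phi_excess divfK // subrr expr0n mulr0 mul0r addr0.
have a_gt0 : 0 < a by rewrite lt_def a_neq0 head_weight_ge0.
have v_gt0 : 0 < d * (theta ^+ 2 * a + d) by rewrite mulr_gt0 ?curvature_gt0.
rewrite gerDl pmulr_lle0 ?invr_gt0 // pmulr_rle0 // => sq_le0.
have : (d - theta * c) ^+ 2 == 0 by rewrite eq_le sq_le0 sqr_ge0.
by rewrite sqrf_eq0 subr_eq0 => /eqP ->; rewrite mulfK.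
Qed.

Lemma head_weight_neq0 (hkn : (k < n)%N) :
  (first_cols hkn S)^T *m r0 != 0 -> a != 0.
Proof.
apply: contraNneq => a0; apply/eqP/colP => i; rewrite first_cols_coef mxE.
have term_ge0 (j : 'I_n) : (j < k)%N -> 0 <= eta j ^+ 2 / lam`_j.
  by move=> _; rewrite divr_ge0 ?sqr_ge0 // ltW // eigenvalue_gt0.
have /eqP := psumr_eq0P term_ge0 a0 (i := widen_ord (ltnW hkn) i) (ltn_ord i).
by rewrite mulf_eq0 invr_eq0 (gt_eqF (eigenvalue_gt0 _)) orbF sqrf_eq0 => /eqP.
Qed.

End Objective.

Theorem theorem4p7 (R : realType) (n k : nat) (hk : (0 < k)%N)
    (hkn : (k < n)%N) (A S : 'M[R]_n) (lam : n.-tuple R) (b x0 : 'cV[R]_n)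
    (hA : sym_posdef A) (hspec : spectral_decomposition A S lam)
    (hden : \sum_(i < n | (k <= i)%N) spec_coef S (residual A b x0) i ^+ 2 != 0) :
  let r0 := residual A b x0 in
  let Sk := first_cols hkn S in
  let Lk := first_diag k lam in
  let minimizers := argmin [set t : R | 0 < t]%classic (Phi A S lam k b x0) in
  let theta_r := (\sum_(i < n | (k <= i)%N) lam`_i * spec_coef S r0 i ^+ 2)
                 / (\sum_(i < n | (k <= i)%N) spec_coef S r0 i ^+ 2) in
  [/\ lam`_n.-1 <= theta_r <= lam`_k,
      minimizers theta_r,
      Sk^T *m r0 != 0 ->
        forall theta : R, lam`_n.-1 <= theta <= lam`_k ->
          minimizers theta -> theta = theta_r
    & theta_r = ((r0^T *m A *m r0) 0 0
                 - (r0^T *m Sk *m Lk *m Sk^T *m r0) 0 0)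
                / ((r0^T *m r0) 0 0 - (r0^T *m Sk *m Sk^T *m r0) 0 0)].
Proof.
move=> r0 Sk Lk minimizers theta_r.
have [orthoS _ lam_last _] := hspec.
pose c := \sum_(i < n | (k <= i)%N) spec_coef S r0 i ^+ 2.
pose d := \sum_(i < n | (k <= i)%N) lam`_i * spec_coef S r0 i ^+ 2.
rewrite {}/theta_r -/c -/d.
have c_gt0 : 0 < c by rewrite lt_def hden tail_norm_ge0.
have d_ge : lam`_n.-1 * c <= d := tail_energy_ge k b x0 hspec.
have d_gt0 : 0 < d by apply: lt_le_trans d_ge; rewrite mulr_gt0.
split.
- by rewrite ler_pdivlMr // ler_pdivrMr // d_ge (tail_energy_le k b x0 hspec).
- by split=> [|u _]; [exact: divr_gt0 | exact: Phi_min].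
- move=> Sr_neq0 theta _ [_ theta_min].
  apply: (Phi_min_unique hA hspec) => //.
    exact: (head_weight_neq0 hspec Sr_neq0).
  by apply: theta_min; exact: divr_gt0.
- have split_head (f : nat -> R) :
      \sum_(i < n | (k <= i)%N) f i * spec_coef S r0 i ^+ 2 =
      \sum_(i < n) f i * spec_coef S r0 i ^+ 2
      - \sum_(i < n | (i < k)%N) f i * spec_coef S r0 i ^+ 2.
    rewrite [X in _ = X - _](bigID (fun i : 'I_n => (i < k)%N)) /= addrAC subrr.
    by rewrite add0r; apply: eq_bigl => i; rewrite -leqNgt.
  congr (_ / _).
    rewrite (first_cols_form hkn S r0 (f := nth 0 lam)); last first.
      by move=> i; rewrite mxE.
    rewrite (spectral_decomposition_mx hspec) spectral_form /d.
    exact: split_head.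
  (* an inserted identity matrix makes this a form of the same shape as the
     one with [Lk] *)
  have -> : r0^T *m Sk *m Sk^T *m r0 =
      r0^T *m Sk *m diag_mx (const_mx 1) *m Sk^T *m r0.
    by rewrite diag_const_mx mulmx1.
  rewrite (first_cols_form hkn S r0 (f := fun=> 1)); last first.
    by move=> i; rewrite mxE.
  rewrite -[r0^T in X in X - _]mulmx1 -(spectral_mx1 orthoS) spectral_form.
  have <- := split_head (fun=> 1).
  by apply: eq_bigr => i _; rewrite mul1r.
Qed.
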